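(* Let $k\in L^1_{\mathrm{loc}}([0,\infty))$ be nonnegative, non-increasing and right-continuous with $\lim_{s\to\infty}k(s)=0$. Let $\gamma\in(0,\infty)$ and $u\in D(\Lambda^k,\mathcal H)$. Then $$\int_0^\infty\langle\Lambda^ku(s),u(s)\rangle_H\,e^{-\gamma s}\,\mathrm ds\le-\frac12\,\psi^k(\gamma)\int_0^\infty\|u(s)\|_H^2\,e^{-\gamma s}\,\mathrm ds.$$
   Context: $(H,\langle\cdot,\cdot\rangle_H)$ is a real separable Hilbert space and $\mathcal H=L^2([0,\infty);H)$. $M^k$ is the unique measure on $((0,\infty),\mathcal B((0,\infty)))$ with $k(s)=M^k((s,\infty))$ for $s\in(0,\infty)$ (so $\int_{(0,\infty)}(\tau\wedge1)M^k(\mathrm d\tau)<\infty$), and $\psi^k(\lambda):=\int_{(0,\infty)}(1-e^{-\lambda\tau})M^k(\mathrm d\tau)$. For $t\ge0$, $\mu_t^k$ is the unique probability measure on $[0,\infty)$ with $\int_{[0,\infty)}e^{-\lambda s}\mu_t^k(\mathrm ds)=e^{-t\psi^k(\lambda)}$ for $\lambda>0$. With the right shifts $U_sf(r):=\mathbf 1_{[0,\infty)}(r-s)f(r-s)$, $r\ge0$, put $U_t^kf:=\int_{[0,\infty)}U_sf\,\mu_t^k(\mathrm ds)=f*\mu_t^k$, $f\in\mathcal H$; this is a $C_0$-semigroup of contractions on $\mathcal H$, and $\Lambda^k$ with domain $D(\Lambda^k,\mathcal H)$ is its infinitesimal generator on $\mathcal H$. *)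

(* Defs.v *)
From HB Require Import structures.
From mathcomp Require Import all_boot all_order all_algebra.
From mathcomp Require Import sesquilinear.
From mathcomp Require Import all_classical all_reals all_analysis.
From mathcomp Require Import measurable_realfun.

Set Implicit Arguments.
Unset Strict Implicit.
Unset Printing Implicit Defensive.

Import Order.TTheory GRing.Theory Num.Theory.
Import numFieldNormedType.Exports.

Local Open Scope classical_set_scope.
Local Open Scope ring_scope.

Definition separable_space (T : topologicalType) : Prop :=
  exists D : set T, countable D /\ dense D.

(* Elements of L^2([0,oo);H) are represented by functions R -> H, of which only
   the values on [0,oo) matter, and equality in L^2 is l2norm (f - g) = 0.  In
   a separable H, Borel and strong measurability coincide. *)

Definition l2norm (R : realType) (H : normedModType R) (f : R -> H) : \bar R :=
  Lnorm (@lebesgue_measure R) 2%:E (EFin \o ((fun r : R => `|f r|) \_ `[0, +oo[)).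

Definition L2 (R : realType) (H : normedModType R) : set (R -> H) :=
  [set f | measurable_fun (`[0, +oo[ : set (measurableTypeR R))
             (f : measurableTypeR R -> g_sigma_algebraType (@open H))
           /\ (l2norm f < +oo)%E].

(* L^2-valued simple functions, the list [:: (A_1, f_1); ...; (A_n, f_n)]
   standing for \1_A_1 f_1 + ... + \1_A_n f_n. *)

Definition simple_wf d (T : measurableType d) (R : realType)
    (H : normedModType R) (mu : {measure set T -> \bar R}) (D : set T)
    (S : seq (set T * (R -> H))) : Prop :=
  forall i, (i < size S)%N ->
    let p := nth (set0, 0) S i in
    [/\ measurable p.1, p.1 `<=` D, (mu p.1 < +oo)%E & L2 p.2].

Definition simple_fun (T : Type) (R : realType) (H : normedModType R)
    (S : seq (set T * (R -> H))) (x : T) : R -> H :=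
  \sum_(p <- S) (\1_(p.1) x : R) *: p.2.

Definition simple_integral d (T : measurableType d) (R : realType)
    (H : normedModType R) (mu : {measure set T -> \bar R})
    (S : seq (set T * (R -> H))) : R -> H :=
  \sum_(p <- S) fine (mu p.1) *: p.2.

(* w is the Bochner integral of g : D -> L^2.  The errors are required to be
   measurable because the library integral of a non-measurable nonnegative
   function is only a lower integral. *)
Definition is_bochner_integral d (T : measurableType d) (R : realType)
    (H : normedModType R) (mu : {measure set T -> \bar R}) (D : set T)
    (g : T -> R -> H) (w : R -> H) : Prop :=
  L2 w /\
  exists S : nat -> seq (set T * (R -> H)),
    [/\ forall n, simple_wf mu D (S n),
        forall n, measurable_fun D (fun s => l2norm (g s - simple_fun (S n) s)),
        (\int[mu]_(s in D) l2norm (g s - simple_fun (S n) s)%R)%E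
          @[n --> \oo] --> 0%E
      & l2norm (simple_integral mu (S n) - w) @[n --> \oo] --> 0%E].

(* Unique up to equality in L^2; 0 if g is not Bochner integrable. *)
Definition bochner_integral d (T : measurableType d) (R : realType)
    (H : normedModType R) (mu : {measure set T -> \bar R}) (D : set T)
    (g : T -> R -> H) : R -> H :=
  xget 0 [set w | is_bochner_integral mu D g w].

Definition right_shift (R : realType) (H : normedModType R) (s : R)
    (f : R -> H) : R -> H :=
  fun r => (\1_(`[0, +oo[ : set R) (r - s) : R) *: f (r - s).

Definition subordinated_shift (R : realType) (H : normedModType R)
    (mu : R -> probability (measurableTypeR R) R) (t : R) (f : R -> H) :
    R -> H :=
  bochner_integral (mu t) `[0, +oo[ (fun s => right_shift s f).

Definition is_generator_value (R : realType) (H : normedModType R)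
    (U : R -> (R -> H) -> R -> H) (u v : R -> H) : Prop :=
  L2 v /\ l2norm (t^-1 *: (U t u - u) - v) @[t --> 0^'+] --> 0%E.

Definition generator_dom (R : realType) (H : normedModType R)
    (U : R -> (R -> H) -> R -> H) : set (R -> H) :=
  [set u | L2 u /\ exists v, is_generator_value U u v].

Definition generator (R : realType) (H : normedModType R)
    (U : R -> (R -> H) -> R -> H) (u : R -> H) : R -> H :=
  xget 0 [set v | is_generator_value U u v].

(* k is a function on (0,oo): it may blow up at 0, as k(s) = s^(-a) does, and
   its value there is irrelevant. *)
Definition admissible_kernel (R : realType) (k : R -> R) : Prop :=
  [/\ forall K : set R, K `<=` `[0, +oo[ -> compact K ->
        (@lebesgue_measure R).-integrable K (EFin \o k),
      forall s : R, 0 < s -> 0 <= k s,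
      forall s t : R, 0 < s -> s <= t -> k t <= k s,
      forall s : R, 0 < s -> k x @[x --> s^'+] --> k s
    & k s @[s --> +oo] --> 0].

(* M^k, as a measure on R carried by (0,oo). *)
Definition is_tail_measure (R : realType) (k : R -> R)
    (M : {measure set (measurableTypeR R) -> \bar R}) : Prop :=
  M `]-oo, 0]%classic = 0%E /\ forall s : R, 0 < s -> M `]s, +oo[%classic = (k s)%:E.

Definition laplace_exponent (R : realType)
    (M : {measure set (measurableTypeR R) -> \bar R}) (lam : R) : R :=
  \int[M]_(tau in `]0, +oo[) (1 - expR (- (lam * tau))).

(* (mu_t^k), as probability measures on R carried by [0,oo). *)
Definition is_subordinator_law (R : realType) (psi : R -> R)
    (mu : R -> probability (measurableTypeR R) R) : Prop :=
  forall t : R, 0 <= t ->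
    mu t `]-oo, 0[%classic = 0%E /\
    forall lam : R, 0 < lam ->
      \int[mu t]_(s in `[0, +oo[) expR (- (lam * s)) = expR (- (t * psi lam)).

(* Main.v *)
Require Import Defs.
From HB Require Import structures.
From mathcomp Require Import all_boot all_order all_algebra.
From mathcomp Require Import sesquilinear.
From mathcomp Require Import all_classical all_reals all_analysis.
From mathcomp Require Import measurable_realfun.
From mathcomp Require Import ring lra.

Set Implicit Arguments.
Unset Strict Implicit.
Unset Printing Implicit Defensive.

Import Order.TTheory GRing.Theory Num.Theory.
Import numFieldNormedType.Exports.

Local Open Scope classical_set_scope.
Local Open Scope ring_scope.

(** Write Phi f for the integral of <f(s), u(s)> exp(-gamma s) over [0,oo); it
    is a linear functional on L^2, bounded by l2norm u, and the theorem is an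
    upper bound for Phi of the generator value v in terms of Phi u, which is
    the weighted square norm of u.

    The exponential weight scales the shifted function down: by
    translation invariance of Lebesgue measure, the weighted square norm of
    the shift U_s u is exp(-gamma s) Phi u.  Splitting <U_s u, u> by the
    arithmetic-geometric mean inequality with a free parameter a > 0 gives
      Phi (U_s u) <= (a + exp(-gamma s) / a) / 2 * Phi u
    ([weighted_pairing_right_shift]).  Integrated against mu_t, whose Laplace
    transform at gamma is exp(-t psi(gamma)), and with a the square root
    exp(-t psi(gamma) / 2) of that number, this becomes
      Phi (U_t u) <= exp(-t psi(gamma) / 2) * Phi u
    ([weighted_pairing_subordinated_shift]).  Keeping a fixed while s varies
    does at once the work of the Cauchy-Schwarz inequality at each s and of
    Jensen's inequality for mu_t.  Subtracting Phi u, dividing by t and letting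
    t tend to 0 from the right yields the factor - psi(gamma) / 2, since the
    difference quotients converge in L^2 and Phi is continuous there.

    The passage of Phi under the Bochner integral
    ([weighted_pairing_bochner_le]) uses only the inequality above at each s:
    the measurability in s is carried by the approximating simple functions
    and by the norms of their errors, measurable by definition.  If the shifts of u had no Bochner integral, U_t u would be 0 by
    convention, and 0 satisfies the bound too because Phi u >= 0. *)

(** * Borel functions with values in a normed space *)

Section BorelValued.
Context d (T : measurableType d) (R : realType) (H : normedModType R).
Local Notation borelH := (g_sigma_algebraType (@open H)).
Implicit Types (D : set T) (f g : T -> H).

Lemma borel_measurableP D f : measurable D ->
  (measurable_fun D (f : T -> borelH) <->
   forall V : set H, open V -> measurable (D `&` f @^-1` V)).
Proof.
move=> mD; split=> [mf V oV|h].
  by apply: mf => //; exact: sub_sigma_algebra.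
apply: (measurability (@open H : set (set borelH))) => //.
by move=> _ [V oV <-]; exact: h.
Qed.

Lemma borel_measurable_comp D f (h : H -> H) : measurable D ->
  continuous h -> measurable_fun D (f : T -> borelH) ->
  measurable_fun D (h \o f : T -> borelH).
Proof.
move=> mD /continuousP ch /(borel_measurableP _ mD) mf.
by apply/borel_measurableP => // V oV; rewrite comp_preimage; exact/mf/ch.
Qed.

Lemma borel_measurable_norm D f : measurable D ->
  measurable_fun D (f : T -> borelH) -> measurable_fun D (fun x => `|f x|).
Proof.
move=> mD /(borel_measurableP _ mD) mf.
have /continuousP cn : continuous (fun x : H => `|x|).
  by move=> x; exact: norm_continuous.
apply: (measurability _ (RGenOpens.measurableE R)) => // _ [_ [a [b ->]] <-].
rewrite (_ : (fun x => `|f x|) = (fun x : H => `|x|) \o f)// comp_preimage.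
by apply/mf/cn; exact: interval_open.
Qed.

(** Separability enters here: an open set containing f x + g x contains
    a sum of two balls of radius 1/n centred in the countable dense set and
    containing f x and g x, so the preimage of an open set under f + g is
    a countable union of intersections of preimages of balls. *)
Lemma borel_measurableD D f g : separable_space H -> measurable D ->
  measurable_fun D (f : T -> borelH) -> measurable_fun D (g : T -> borelH) ->
  measurable_fun D ((fun x => f x + g x) : T -> borelH).
Proof.
move=> [E [cE dE]] mD /(borel_measurableP _ mD) mf /(borel_measurableP _ mD) mg.
apply/borel_measurableP => // V oV.
pose B (p : H) (n : nat) : set H := ball p n.+1%:R^-1.
pose I : set (H * H * nat) := [set i | [/\ E i.1.1, E i.1.2 &
  forall p q, B i.1.1 i.2 p -> B i.1.2 i.2 q -> V (p + q)]].
have cI : countable I.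
  apply: (@sub_countable _ _ _ ((E `*` E) `*` [set: nat])).
    by apply: subset_card_le => -[[p q] n] [].
  by apply: countableX => //; exact: countableX.
rewrite (_ : _ `&` _ = \bigcup_(i in I)
    ((D `&` f @^-1` B i.1.1 i.2) `&` (D `&` g @^-1` B i.1.2 i.2))).
  rewrite bigcup_set_type; apply: countable_bigcupT_measurable => [|i].
    by rewrite (eq_countable (card_setT I)).
  by apply: measurableI; [apply: mf|apply: mg]; exact: ball_open.
apply/seteqP; split => [x [Dx /= Ofg]|x [[[p q] n] [_ _ h]]]; last first.
  by move=> [[Dx fB] [_ gB]]; split => //; exact: h fB gB.
move: (open_nbhs_nbhs (conj oV Ofg)) => /nbhs_ballP[e /= e0 eV].
have [n ne] : exists n, (n.+1%:R^-1 : R) < e / 4.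
  have e40 : 0 < e / 4 by rewrite divr_gt0.
  have [n _ /(_ n (leqnn n))] := near_infty_natSinv_lt (PosNum e40).
  by exists n.
have n0 : 0 < (n.+1%:R^-1 : R) by rewrite invr_gt0.
have dns (z : H) : exists2 p, E p & ball p n.+1%:R^-1 z.
  have [|p [zp Ep]] := dE (ball z n.+1%:R^-1) _ (ball_open _ _).
    by exists z; exact: ballxx.
  by exists p => //; exact: ball_sym.
have [p Ep pf] := dns (f x); have [q Eq qg] := dns (g x).
exists ((p, q), n) => //; split=> //= a b; rewrite /B -ball_normE/= => pa qb.
apply: eV; rewrite -ball_normE/=.
move: pf qg; rewrite -ball_normE/= => pf qg.
rewrite opprD addrACA (le_lt_trans (ler_normD _ _))//.
have := ler_distD p (f x) a; have := ler_distD q (g x) b.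
rewrite distrC in pf; rewrite distrC in qg => h1 h2.
move: n.+1%:R^-1 ne pa qb pf qg => r *.
lra.
Qed.

End BorelValued.

(** * Square-integrable functions *)

Section SquareIntegrable.
Context (R : realType) (H : normedModType R).
Local Notation leb := (@lebesgue_measure R).
Local Notation Rp := (`[0, +oo[%classic : set (measurableTypeR R)).
Local Notation borelH := (g_sigma_algebraType (@open H)).
Implicit Types f g : R -> H.

Lemma sqr_l2norm f :
  (l2norm f `^ 2 = \int[leb]_(r in Rp) (`|f r| ^+ 2)%:E)%E.
Proof.
rewrite /l2norm poweR_Lnorm// [RHS]integral_mkcond.
apply: eq_integral => x _; rewrite /patch/=.
by case: ifPn => _ /=; rewrite ?normr_id ?normr0 powR_mulrn// expr0n.
Qed.

(** Working with integrability of the squared norm avoids any use of the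
    root in the L^2 norm, in particular of Minkowski's inequality. *)
Lemma L2P f : L2 f <->
  measurable_fun Rp (f : measurableTypeR R -> borelH) /\
  leb.-integrable Rp (fun r => (`|f r| ^+ 2)%:E).
Proof.
rewrite /L2/=; split=> -[mf].
  move=> f2; split => //; apply/integrableP; split.
    apply/measurable_EFinP; apply: measurable_funX.
    exact: borel_measurable_norm.
  under eq_integral do rewrite gee0_abs ?lee_fin ?exprn_ge0//.
  by rewrite -sqr_l2norm poweR_lty.
move=> /integrableP[_ f2]; split=> //.
move: f2; under eq_integral do rewrite gee0_abs ?lee_fin ?exprn_ge0//.
rewrite -sqr_l2norm ltey => l2f; rewrite ltey; apply: contra_neq l2f => ->.
by rewrite poweRyr.
Qed.

Lemma L2_measurable f : L2 f ->
  measurable_fun Rp (f : measurableTypeR R -> borelH).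
Proof. by case. Qed.

Lemma L2_fin_num f : L2 f -> l2norm f \is a fin_num.
Proof. by move=> [_ /= f2]; rewrite ge0_fin_numE// Lnorm_ge0. Qed.

Lemma L2_integrable f : L2 f -> leb.-integrable Rp (fun r => (`|f r| ^+ 2)%:E).
Proof. by case/L2P. Qed.

Lemma L2D f g : separable_space H -> L2 f -> L2 g -> L2 (f + g).
Proof.
move=> sepH /L2P[mf f2] /L2P[mg g2]; apply/L2P.
have mfg : measurable_fun Rp (f + g : measurableTypeR R -> borelH).
  exact: borel_measurableD.
split => //.
pose b r := ((2 * `|f r| ^+ 2)%:E + (2 * `|g r| ^+ 2)%:E)%E.
apply: (@le_integrable _ (measurableTypeR R) R leb Rp _ _ b) => //.
- apply/measurable_EFinP; apply: measurable_funX.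
  exact: borel_measurable_norm.
- move=> r _; rewrite /b -EFinD/= lee_fin !ger0_norm ?addr_ge0 ?mulr_ge0 ?exprn_ge0//.
  have h := ler_normD (f r) (g r).
  rewrite (@le_trans _ _ ((`|f r| + `|g r|) ^+ 2))//.
    by rewrite ler_pXn2r ?nnegrE ?addr_ge0.
  have := sqr_ge0 (`|f r| - `|g r|); nra.
- by apply: integrableD => //; [apply: (integrableZl _ 2) f2|
    apply: (integrableZl _ 2) g2].
Qed.

Lemma L2Z (c : R) f : L2 f -> L2 (c *: f).
Proof.
move=> /L2P[mf f2]; apply/L2P; split.
  apply: (@borel_measurable_comp _ _ _ _ _ f ( *:%R c)) => //.
  by move=> x; exact: scaler_continuous.
rewrite [X in leb.-integrable _ X](_ : _ =
    (fun r => (`|c| ^+ 2)%:E * (`|f r| ^+ 2)%:E)%E).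
  exact: integrableZl.
by apply/funext => r; rewrite -EFinM -exprMn -normrZ.
Qed.

Lemma L2B f g : separable_space H -> L2 f -> L2 g -> L2 (f - g).
Proof. by move=> sepH f2 g2; rewrite -scaleN1r; apply: L2D => //; exact: L2Z. Qed.

Lemma L20 : L2 (0 : R -> H).
Proof.
apply/L2P; split; first exact: measurable_cst.
rewrite [X in leb.-integrable _ X](_ : _ = cst 0%E); first exact: integrable0.
by apply/funext => r /=; rewrite [X in `|X|](_ : _ = 0)// normr0 expr0n.
Qed.

End SquareIntegrable.

(** * The weighted pairing with u *)

Section WeightedPairing.
Context (R : realType) (H : normedModType R) (ip : {dot H for idfun}).
Hypothesis ip_norm : forall x : H, ip x x = `|x| ^+ 2.
Hypothesis sepH : separable_space H.
Local Notation leb := (@lebesgue_measure R).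
Local Notation Rp := (`[0, +oo[%classic : set (measurableTypeR R)).
Local Notation borelH := (g_sigma_algebraType (@open H)).

(** Through this identity the measurability of <f, u> reduces to that of
    norms of sums. *)
Lemma dot_polarization x y :
  ip x y = 2^-1 * (`|x + y| ^+ 2 - `|x| ^+ 2 - `|y| ^+ 2).
Proof.
have ipC : ip y x = ip x y.
  by transitivity ((-1) ^+ false * idfun (ip x y));
    [exact: hermC|rewrite expr0 mul1r].
rewrite -!ip_norm linearDl !linearDr/= ipC; lra.
Qed.

Lemma dot_le_norm x y : ip x y <= `|x| * `|y|.
Proof.
have : `|x + y| ^+ 2 <= (`|x| + `|y|) ^+ 2.
  by rewrite ler_pXn2r ?nnegrE ?addr_ge0 ?ler_normD.
rewrite dot_polarization; lra.
Qed.

Lemma norm_dot_le x y : `|ip x y| <= `|x| * `|y|.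
Proof.
by rewrite ler_norml dot_le_norm lerNl -linearNl -(normrN x) dot_le_norm.
Qed.

Variables (gamma : R) (u : R -> H).
Hypotheses (gamma0 : 0 <= gamma) (u2 : L2 u).

Definition weighted_pairing (f : R -> H) : R :=
  \int[leb]_(s in Rp) (ip (f s) (u s) * expR (- (gamma * s))).

Lemma weight_le1 s : Rp s -> expR (- (gamma * s)) <= 1.
Proof.
rewrite /= in_itv/= andbT => s0.
by rewrite -expR0 ler_expR oppr_le0 mulr_ge0.
Qed.

Lemma measurable_weight (D : set (measurableTypeR R)) :
  measurable_fun D (fun s => expR (- (gamma * s))).
Proof.
apply: measurable_funTS; apply: measurableT_comp => //.
by apply: measurable_funN; exact: measurable_funM.
Qed.

Lemma measurable_dot (f : R -> H) : L2 f ->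
  measurable_fun Rp (fun s => ip (f s) (u s)).
Proof.
move=> f2; rewrite (_ : (fun s => _) = fun s => 2^-1 *
    (`|f s + u s| ^+ 2 - `|f s| ^+ 2 - `|u s| ^+ 2)); last first.
  by apply/funext => s; exact: dot_polarization.
apply: measurable_funM => //; apply: measurable_funB; [apply: measurable_funB|];
  apply: measurable_funX; apply: borel_measurable_norm => //;
  try exact: L2_measurable.
by apply: borel_measurableD => //; exact: L2_measurable.
Qed.

Lemma integrable_pairing (f : R -> H) : L2 f -> leb.-integrable Rp
  (EFin \o (fun s => ip (f s) (u s) * expR (- (gamma * s)))).
Proof.
move=> f2.
pose b r := ((`|f r| ^+ 2)%:E + (`|u r| ^+ 2)%:E)%E.
apply: (@le_integrable _ (measurableTypeR R) R leb Rp _ _ b) => //.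
- apply/measurable_EFinP; apply: measurable_funM; first exact: measurable_dot.
  exact: measurable_weight.
- move=> r Dr; rewrite /b -EFinD/= lee_fin normrM.
  rewrite [leRHS]ger0_norm ?addr_ge0 ?exprn_ge0//.
  rewrite (ger0_norm (expR_ge0 _)) (@le_trans _ _ (`|f r| * `|u r|))//.
    rewrite -[leRHS]mulr1; apply: ler_pM; rewrite ?expR_ge0 ?norm_dot_le//.
    exact: weight_le1.
  have := sqr_ge0 (`|f r| - `|u r|).
  have := sqr_ge0 (`|f r| + `|u r|); nra.
- by apply: integrableD => //; exact: L2_integrable.
Qed.

Lemma weighted_pairingD f g : L2 f -> L2 g ->
  weighted_pairing (f + g) = weighted_pairing f + weighted_pairing g.
Proof.
move=> f2 g2; rewrite /weighted_pairing -RintegralD//; [|exact: integrable_pairing..].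
by apply: eq_Rintegral => s _; rewrite linearDl mulrDl.
Qed.

Lemma weighted_pairingZ c f : L2 f ->
  weighted_pairing (c *: f) = c * weighted_pairing f.
Proof.
move=> f2; rewrite /weighted_pairing -RintegralZl//; last exact: integrable_pairing.
by apply: eq_Rintegral => s _; rewrite linearZl_LR/= mulrA.
Qed.

Lemma weighted_pairingB f g : L2 f -> L2 g ->
  weighted_pairing (f - g) = weighted_pairing f - weighted_pairing g.
Proof.
move=> f2 g2; rewrite -scaleN1r weighted_pairingD//; last exact: L2Z.
by rewrite weighted_pairingZ// mulN1r.
Qed.

Lemma weighted_pairing0 : weighted_pairing 0 = 0.
Proof.
by rewrite -(scale0r (0 : R -> H)) weighted_pairingZ ?mul0r//; exact: L20.
Qed.

(** The weight is at most 1 on [0,oo), so Hoelder's inequality with exponents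
    2 and 2 bounds the pairing by the unweighted norms. *)
Lemma norm_weighted_pairing_le f : L2 f ->
  (`|weighted_pairing f|%:E <= l2norm u * l2norm f)%E.
Proof.
move=> f2; rewrite /weighted_pairing.
have mN (h : R -> H) : L2 h ->
    measurable_fun [set: measurableTypeR R] ((fun r => `|h r|) \_ Rp).
  move=> h2; apply/(measurable_restrictT _ _).1 => //.
  by apply: borel_measurable_norm => //; exact: L2_measurable.
have := @hoelder _ (measurableTypeR R) R leb _ _ 2 2 (mN _ u2) (mN _ f2)
  ltac:(by []) ltac:(by []) ltac:(by lra).
apply: le_trans.
rewrite Lnorm1 EFin_normr_Rintegral//; last exact: integrable_pairing.
have [mI _] := integrableP _ _ _ (integrable_pairing f2).
apply: (@le_trans _ _ (\int[leb]_(s in Rp) (`|u s| * `|f s|)%:E)%E).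
  apply: (le_trans (le_abse_integral _ _ _)) => //.
  apply: ge0_le_integral => //.
  - exact: measurableT_comp.
  - apply/measurable_EFinP; apply: measurable_funM;
      by apply: borel_measurable_norm => //; exact: L2_measurable.
  - move=> s Ds; rewrite /= lee_fin normrM (ger0_norm (expR_ge0 _)) mulrC.
    rewrite (mulrC `|u s|) -[leRHS]mul1r.
    by apply: ler_pM => //; [exact: weight_le1|exact: norm_dot_le].
rewrite [leLHS]integral_mkcond; apply: ge0_le_integral => //.
- by move=> s _; rewrite /patch; case: ifP => // _; rewrite lee_fin mulr_ge0.
- apply/(measurable_restrictT _ _).1 => //.
  apply/measurable_EFinP; apply: measurable_funM;
    by apply: borel_measurable_norm => //; exact: L2_measurable.
- apply/measurable_EFinP; apply: measurableT_comp => //.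
  by apply: measurable_funM; exact: mN.
- move=> s _; rewrite /patch/=.
  by case: ifP => _; rewrite lee_fin ?normrM ?normr_id// mulr0 normr0.
Qed.

End WeightedPairing.

(** * Right shifts *)

Section RightShift.
Context (R : realType) (H : normedModType R) (ip : {dot H for idfun}).
Hypothesis ip_norm : forall x : H, ip x x = `|x| ^+ 2.
Hypothesis sepH : separable_space H.
Local Notation leb := (@lebesgue_measure R).
Local Notation Rp := (`[0, +oo[%classic : set (measurableTypeR R)).
Local Notation borelH := (g_sigma_algebraType (@open H)).

Lemma measurable_subr (s : R) :
  measurable_fun [set: measurableTypeR R]
    ((fun r => r - s) : measurableTypeR R -> measurableTypeR R).
Proof. exact: measurable_funB. Qed.

Lemma preimage_subr_itv (s : R) :
  (fun r => r - s) @^-1` `[0, +oo[%classic = `[s, +oo[%classic.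
Proof.
by apply/seteqP; split=> r /=; rewrite !in_itv/= !andbT subr_ge0.
Qed.

Lemma lebesgue_measure_subr (s : R) (A : set R) : measurable A ->
  pushforward leb ((fun r => r - s) : measurableTypeR R -> measurableTypeR R) A
  = leb A.
Proof.
move=> mA.
pose phi : measurableTypeR R -> measurableTypeR R := fun r => r - s.
have mphi : measurable_fun setT phi := measurable_subr s.
pose phi_mixin := isMeasurableFun.Build _ _ _ _ _ mphi.
pose phi' : {mfun measurableTypeR R >-> measurableTypeR R} := HB.pack phi phi_mixin.
apply/esym; apply: (@lebesgue_measure_unique R (pushforward leb phi')) => //.
move=> _ [[a b] _ <-]; rewrite /= /pushforward.
have -> : phi @^-1` `]a, b]%classic = `]a + s, b + s]%classic.
  by apply/seteqP; split=> r /=; rewrite !in_itv/= ltrBrDr lerBlDr.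
rewrite !lebesgue_measure_itv/= !lte_fin ltrD2r -!EFinB.
by case: ifP => // _; congr EFin; ring.
Qed.

Lemma integral_subr (s : R) (h : R -> \bar R) :
  measurable_fun Rp (h : measurableTypeR R -> \bar R) ->
  (forall r, 0 <= h r)%E ->
  (\int[leb]_(r in `[s, +oo[) h (r - s)%R = \int[leb]_(r in Rp) h r)%E.
Proof.
move=> mh h0; rewrite -preimage_subr_itv.
rewrite -(@ge0_integral_pushforward _ _ _ _ _ _ (measurable_subr s) _ _ h)//.
apply: eq_measure_integral => [|mp A mA _]; first exact: measurable_subr.
exact: (lebesgue_measure_subr s mA).
Qed.

Lemma right_shiftE (s : R) (f : R -> H) r :
  right_shift s f r = if s <= r then f (r - s) else 0.
Proof.
rewrite /right_shift indicE.
case: ifPn => sr; first by rewrite mem_set ?scale1r//= in_itv/= subr_ge0 sr.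
by rewrite memNset ?scale0r//= in_itv/= subr_ge0 andbT; exact/negP.
Qed.

Lemma itv_splitU (s : R) : 0 <= s ->
  `[0, +oo[%classic = `[0, s[%classic `|` `[s, +oo[%classic.
Proof.
move=> s0; apply/seteqP; split=> r /=; rewrite !in_itv/= !andbT.
  by move=> ->; case: ltP => h; [left|right].
by case=> [/andP[]//|]; exact: le_trans.
Qed.

Lemma measurable_right_shift (s : R) (f : R -> H) : 0 <= s ->
  measurable_fun Rp (f : measurableTypeR R -> borelH) ->
  measurable_fun Rp (right_shift s f : measurableTypeR R -> borelH).
Proof.
move=> s0 mf; rewrite (itv_splitU s0); apply/measurable_funU => //; split.
  apply: (eq_measurable_fun (cst 0 : measurableTypeR R -> borelH)) => //.
  move=> r /[!inE]/= /[!in_itv]/= /andP[_ rs].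
  by rewrite /= right_shiftE leNgt rs.
apply: (eq_measurable_fun ((fun r => f (r - s)) : measurableTypeR R -> borelH)).
  move=> r /[!inE]/= /[!in_itv]/= /[!andbT] sr.
  by rewrite /= right_shiftE sr.
apply: (measurable_comp _ _ mf) => //.
- by move=> _ [r /= rs <-]; move: rs; rewrite !in_itv/= !andbT subr_ge0.
- exact: measurable_funTS (measurable_subr s).
Qed.

(** The part of [0,oo) before s contributes nothing, and after the change of
    variable the weight at r + s factors as exp(-gamma s) exp(-gamma r). *)
Lemma integral_right_shift (gamma s : R) (f : R -> H) : 0 <= s -> L2 f ->
  (\int[leb]_(r in Rp) (`|right_shift s f r| ^+ 2 * expR (- (gamma * r)))%:E =
   (expR (- (gamma * s)))%:E *
     \int[leb]_(r in Rp) (`|f r| ^+ 2 * expR (- (gamma * r)))%:E)%E.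
Proof.
move=> s0 /L2_measurable mf.
have mh : measurable_fun Rp (fun r => (`|f r| ^+ 2 * expR (- (gamma * r)))%:E).
  apply/measurable_EFinP; apply: measurable_funM; last exact: measurable_weight.
  by apply: measurable_funX; exact: borel_measurable_norm.
rewrite -ge0_integralZl//.
rewrite -[RHS](integral_subr s); last 2 first.
- exact: measurable_funeM.
- by move=> r; rewrite lee_fin !mulr_ge0 ?exprn_ge0 ?expR_ge0.
rewrite [LHS]integral_mkcond [RHS]integral_mkcond; apply: eq_integral => r _.
rewrite /patch !mem_setE !in_itv/= !andbT right_shiftE.
case: (leP s r) => [sr|rs]; last by rewrite normr0 expr0n mul0r; case: ifP.
rewrite (le_trans s0 sr) -EFinM mulrCA -expRD; congr (_ * expR _)%:E; ring.
Qed.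

Lemma L2_right_shift (s : R) (f : R -> H) : 0 <= s -> L2 f ->
  L2 (right_shift s f).
Proof.
move=> s0 f2; have /L2P[mf /integrableP[_ fi]] := f2.
apply/L2P; split; first exact: measurable_right_shift.
have ms := measurable_right_shift s0 mf.
apply/integrableP; split.
  apply/measurable_EFinP; apply: measurable_funX.
  exact: borel_measurable_norm.
(* The weight is trivial for gamma = 0. *)
have := integral_right_shift 0 s0 f2.
have E0 (g : R -> H) : (\int[leb]_(r in Rp) (`|g r| ^+ 2 * expR (- (0 * r)))%:E =
    \int[leb]_(r in Rp) `|(`|g r| ^+ 2)%:E|)%E.
  apply: eq_integral => r _.
  by rewrite mul0r oppr0 expR0 mulr1 gee0_abs// lee_fin exprn_ge0.
by rewrite !E0 mul0r oppr0 expR0 mul1e => ->.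
Qed.

Variables (gamma : R) (u : R -> H).
Hypotheses (gamma0 : 0 <= gamma) (u2 : L2 u).

Lemma weighted_pairing_self (f : R -> H) : weighted_pairing ip gamma f f =
  \int[leb]_(s in Rp) (`|f s| ^+ 2 * expR (- (gamma * s))).
Proof. by apply: eq_Rintegral => s _; rewrite ip_norm. Qed.

Lemma integrable_weighted_sqr (f : R -> H) : L2 f -> leb.-integrable Rp
  (EFin \o (fun s => `|f s| ^+ 2 * expR (- (gamma * s)))).
Proof.
move=> f2; rewrite (_ : _ \o _ = EFin \o
   (fun s => ip (f s) (f s) * expR (- (gamma * s)))).
  exact: integrable_pairing.
by apply/funext => s /=; rewrite ip_norm.
Qed.

(** x y <= (a y^2 + x^2 / a) / 2 with x the shifted norm and y the norm of u;
    a is free, so that it can later be chosen uniformly in s. *)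
Lemma weighted_pairing_right_shift (s a : R) : 0 <= s -> 0 < a ->
  weighted_pairing ip gamma u (right_shift s u) <=
  2^-1 * (a + a^-1 * expR (- (gamma * s))) * weighted_pairing ip gamma u u.
Proof.
move=> s0 a0; have su2 := L2_right_shift s0 u2.
have iu := integrable_weighted_sqr u2; have isu := integrable_weighted_sqr su2.
have -> : 2^-1 * (a + a^-1 * expR (- (gamma * s))) * weighted_pairing ip gamma u u
  = \int[leb]_(r in Rp)
     ((2^-1 * a) * (`|u r| ^+ 2 * expR (- (gamma * r))) +
      (2^-1 * a^-1) * (`|right_shift s u r| ^+ 2 * expR (- (gamma * r)))).
  rewrite RintegralD//; [|exact: (integrableZl _ (2^-1 * a) iu)|
                          exact: (integrableZl _ (2^-1 * a^-1) isu)].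
  rewrite !RintegralZl// -!weighted_pairing_self.
  rewrite [in RHS](weighted_pairing_self (right_shift s u)).
  rewrite [X in _ * _ + _ * X](_ : _ =
      expR (- (gamma * s)) * weighted_pairing ip gamma u u); first by ring.
  rewrite weighted_pairing_self /Rintegral integral_right_shift// fineM//.
  exact: (integrable_fin_num _ iu).
rewrite /weighted_pairing; apply: le_Rintegral => //.
- exact: integrable_pairing.
- exact: (integrableD _ (integrableZl _ (2^-1 * a) iu)
                        (integrableZl _ (2^-1 * a^-1) isu)).
move=> r _; rewrite !mulrA -mulrDl ler_wpM2r ?expR_ge0//.
rewrite (le_trans (dot_le_norm ip_norm _ _))//.
(* The difference of the two sides is a nonnegative multiple of a square. *)
set x := `|_|; set y := `|_|.
have : 0 <= 2^-1 * a^-1 * (x - a * y) ^+ 2.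
  by rewrite mulr_ge0 ?sqr_ge0// mulr_ge0 ?invr_ge0 ?(ltW a0).
rewrite (_ : _ * _ = 2^-1 * a * y ^+ 2 + 2^-1 / a * x ^+ 2 - x * y).
  by rewrite subr_ge0 !expr2 !mulrA.
by field; rewrite gt_eqF.
Qed.

End RightShift.

(** * The pairing of a Bochner integral *)

Section BochnerPairing.
Context (R : realType) (H : normedModType R) (ip : {dot H for idfun}).
Hypothesis ip_norm : forall x : H, ip x x = `|x| ^+ 2.
Hypothesis sepH : separable_space H.
Variables (gamma : R) (u : R -> H).
Hypotheses (gamma0 : 0 <= gamma) (u2 : L2 u).
Local Notation Phi := (weighted_pairing ip gamma u).

Lemma weighted_pairing_simple_integral d (T : measurableType d)
    (mu : {measure set T -> \bar R}) (D : set T) (S : seq (set T * (R -> H))) :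
  measurable D -> simple_wf mu D S ->
  [/\ forall s, L2 (simple_fun S s), L2 (simple_integral mu S),
      mu.-integrable D (fun s => (Phi (simple_fun S s))%:E) &
      (\int[mu]_(s in D) (Phi (simple_fun S s))%:E =
       (Phi (simple_integral mu S))%:E)%E].
Proof.
move=> mD; elim: S => [_|[A f] S IH wf].
  have sf0 s : simple_fun [::] s = 0 :> (R -> H) by rewrite /simple_fun big_nil.
  have si0 : simple_integral mu [::] = 0 :> (R -> H).
    by rewrite /simple_integral big_nil.
  have P0 : Phi 0 = 0 by exact: weighted_pairing0.
  split=> [s|||].
  - by rewrite sf0; exact: L20.
  - by rewrite si0; exact: L20.
  - by under eq_fun do rewrite sf0 P0; exact: integrable0.
  - by under eq_integral do rewrite sf0 P0; rewrite si0 P0 integral0.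
have [/= mA AD muA f2] := wf 0%N isT.
have {IH}[S2 I2 iS eS] := IH (fun i iS => wf i.+1 iS).
have sfE s : simple_fun ((A, f) :: S) s = (\1_A s : R) *: f + simple_fun S s.
  by rewrite /simple_fun big_cons.
have siE : simple_integral mu ((A, f) :: S) =
    fine (mu A) *: f + simple_integral mu S.
  by rewrite /simple_integral big_cons.
have PE s : (Phi (simple_fun ((A, f) :: S) s))%:E =
    ((Phi f)%:E * (\1_A s)%:E + (Phi (simple_fun S s))%:E)%E.
  rewrite sfE weighted_pairingD//; last exact: L2Z.
  by rewrite weighted_pairingZ// mulrC EFinD EFinM.
have iA : mu.-integrable D (fun s => (\1_A s : R)%:E).
  apply/integrableP; split; first exact/measurable_EFinP.
  under eq_integral do rewrite gee0_abs ?lee_fin//.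
  by rewrite integral_indic// setIidl.
have iAf := integrableZl mD (Phi f) iA.
split=> [s|||].
- by rewrite sfE; apply: L2D => //; exact: L2Z.
- by rewrite siE; apply: L2D => //; exact: L2Z.
- by under eq_fun do rewrite PE; exact: integrableD.
- under eq_integral do rewrite PE.
  rewrite integralD// eS integralZl// integral_indic// setIidl//.
  rewrite siE weighted_pairingD//; last exact: L2Z.
  have muAf : mu A \is a fin_num by rewrite ge0_fin_numE.
  by rewrite weighted_pairingZ// EFinD EFinM (fineK muAf) muleC.
Qed.

(** Phi is continuous for the L^2 norm, so it can be taken on the simple
    functions S_n, where it commutes with the integral by linearity; both the
    error in S_n(s) and the error in the integral of S_n vanish in the limit.
    Bounding Phi (g s) by an integrable h keeps the measurability of
    s |-> Phi (g s) out of the argument. *)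
Lemma weighted_pairing_bochner_le d (T : measurableType d)
    (mu : {measure set T -> \bar R}) (D : set T) (g : T -> R -> H)
    (h : T -> R) (w : R -> H) :
  measurable D -> is_bochner_integral mu D g w ->
  (forall s, D s -> L2 (g s)) ->
  mu.-integrable D (EFin \o h) -> (forall s, D s -> Phi (g s) <= h s) ->
  Phi w <= \int[mu]_(s in D) h s.
Proof.
move=> mD [w2 [S [wf mS cvS cvw]]] g2 ih gh.
pose e n := (\int[mu]_(s in D) l2norm (g s - simple_fun (S n) s)%R)%E.
pose z n := l2norm (simple_integral mu (S n) - w)%R.
have u2f := L2_fin_num u2.
have eoo : \forall n \near \oo, e n \is a fin_num by exact: cvg_is_fine cvS.
have cvb : ((l2norm u * e n + (\int[mu]_(s in D) h s)%R%:E + l2norm u * z n)%E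
    @[n --> \oo] -->
    (l2norm u * 0 + (\int[mu]_(s in D) h s)%R%:E + l2norm u * 0)%E)%E.
  apply: cvgeD; [by rewrite !mule0 add0e| |exact: cvgeZl].
  by apply: cvgeD; [by rewrite mule0|exact: cvgeZl|exact: cvg_cst].
rewrite !mule0 add0e adde0 in cvb.
rewrite -lee_fin; apply: cvge_to_ge cvb _.
near=> n.
have en : e n \is a fin_num by near: n.
have [sf2 si2 isf eqI] := weighted_pairing_simple_integral mD (wf n).
have ierr : mu.-integrable D (fun s => l2norm (g s - simple_fun (S n) s)%R).
  apply/integrableP; split; first exact: mS.
  under eq_integral do rewrite gee0_abs ?Lnorm_ge0//.
  by rewrite -ge0_fin_numE// integral_ge0// => s _; exact: Lnorm_ge0.
have iuerr : mu.-integrable D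
    (fun s => l2norm u * l2norm (g s - simple_fun (S n) s)%R)%E.
  by rewrite -(fineK u2f); exact: integrableZl.
have step1 : ((Phi (simple_integral mu (S n)))%:E <=
    l2norm u * e n + (\int[mu]_(s in D) h s)%R%:E)%E.
  rewrite /Rintegral fineK; last exact: integrable_fin_num.
  rewrite -eqI /e -{1}(fineK u2f) -integralZl// fineK//.
  rewrite -integralD//; apply: le_integral => //.
    exact: integrableD.
  move=> s /set_mem Ds; have gs2 := g2 _ Ds.
  have := norm_weighted_pairing_le ip_norm sepH gamma0 u2 (L2B sepH gs2 (sf2 s)).
  rewrite weighted_pairingB// => err.
  rewrite (@le_trans _ _ (`|Phi (g s) - Phi (simple_fun (S n) s)|%:E + (h s)%:E)%E)//.
    rewrite -EFinD lee_fin; have := gh _ Ds.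
    have := ler_norm (- (Phi (g s) - Phi (simple_fun (S n) s))).
    rewrite normrN; lra.
  by rewrite leeD2r.
have := norm_weighted_pairing_le ip_norm sepH gamma0 u2 (L2B sepH si2 w2).
rewrite weighted_pairingB// => err.
rewrite (@le_trans _ _ ((Phi (simple_integral mu (S n)))%:E +
   `|Phi (simple_integral mu (S n)) - Phi w|%:E)%E)//.
  rewrite -EFinD lee_fin.
  have := ler_norm (- (Phi (simple_integral mu (S n)) - Phi w)).
  rewrite normrN; lra.
by rewrite leeD.
Unshelve. all: by end_near. Qed.

End BochnerPairing.

(** * The subordinated shifts *)

Section SubordinatedShift.
Context (R : realType) (H : normedModType R) (ip : {dot H for idfun}).
Hypothesis ip_norm : forall x : H, ip x x = `|x| ^+ 2.
Hypothesis sepH : separable_space H.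
Variables (gamma : R) (u : R -> H).
Hypotheses (gamma0 : 0 <= gamma) (u2 : L2 u).
Local Notation Phi := (weighted_pairing ip gamma u).
Local Notation Rp := (`[0, +oo[%classic : set (measurableTypeR R)).

Lemma L2_subordinated_shift (mu : R -> probability (measurableTypeR R) R) t f :
  L2 (@subordinated_shift R H mu t f).
Proof.
rewrite /subordinated_shift /bochner_integral.
by case: xgetP => [w _ []//|_]; exact: L20.
Qed.

Lemma weighted_pairing_self_ge0 : 0 <= Phi u.
Proof.
rewrite weighted_pairing_self//; apply: Rintegral_ge0 => s _.
by rewrite mulr_ge0 ?exprn_ge0 ?expR_ge0.
Qed.

(** With the integral of exp(-gamma s) equal to a^2, the average of
    (a + exp(-gamma s) / a) / 2 is exactly a. *)
Lemma weighted_pairing_subordinated_shift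
    (mu : R -> probability (measurableTypeR R) R) (t a : R) :
  mu t `]-oo, 0[%classic = 0%E -> 0 < a ->
  \int[mu t]_(s in Rp) expR (- (gamma * s)) = a ^+ 2 ->
  Phi (@subordinated_shift R H mu t u) <= a * Phi u.
Proof.
move=> mu0 a0 mua.
rewrite /subordinated_shift /bochner_integral.
case: xgetP => [w _ wB|_]; last first.
  (* The junk value 0 of a missing Bochner integral. *)
  have -> : Phi 0 = 0 by exact: weighted_pairing0.
  by rewrite mulr_ge0 ?(ltW a0) ?weighted_pairing_self_ge0.
have iexp : (mu t).-integrable Rp (EFin \o (fun s => expR (- (gamma * s)))).
  apply: (@le_integrable _ (measurableTypeR R) R (mu t) Rp _ _ (cst 1%E)) => //.
  - by apply/measurable_EFinP; exact: measurable_weight.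
  - move=> s Ds; rewrite /= lee_fin normr1 ger0_norm ?expR_ge0//.
    exact: weight_le1.
  - exact: finite_measure_integrable_cst.
have muR : mu t Rp = 1%E.
  have := probability_setC (mu t) (measurable_itv `]-oo, (0:R)[).
  by rewrite setCitvl mu0 sube0.
have ih : (mu t).-integrable Rp (EFin \o (fun s =>
    2^-1 * a * Phi u + 2^-1 * a^-1 * Phi u * expR (- (gamma * s)))).
  have ic : (mu t).-integrable Rp (EFin \o cst (2^-1 * a * Phi u)).
    exact: finite_measure_integrable_cst.
  exact: (integrableD _ ic (integrableZl _ (2^-1 * a^-1 * Phi u) iexp)).
apply: (le_trans (weighted_pairing_bochner_le ip_norm sepH gamma0 u2 _ wB _ ih _)) => //.
- by move=> s /=; rewrite in_itv/= andbT => s0; exact: L2_right_shift.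
- move=> s /=; rewrite in_itv/= andbT => s0.
  rewrite (le_trans (weighted_pairing_right_shift ip_norm sepH gamma0 u2 s0 a0))//.
  by rewrite le_eqVlt; apply/orP; left; apply/eqP; ring.
rewrite RintegralD//; last 2 first.
- exact: finite_measure_integrable_cst.
- exact: (integrableZl _ (2^-1 * a^-1 * Phi u) iexp).
rewrite Rintegral_cst// RintegralZl// mua [X in fine X](_ : _ = 1%E)//=.
by rewrite le_eqVlt; apply/orP; left; apply/eqP; field; rewrite gt_eqF.
Qed.

End SubordinatedShift.

Lemma cvg_expR_quotient (R : realType) (k : R) :
  t^-1 * (expR (k * t) - 1) @[t --> 0^'+] --> k.
Proof.
have dk : is_derive (0 : R) 1 (fun t => expR (k * t)) k.
  have dl := is_deriveZ k (is_derive_id (0 : R) 1).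
  have := is_derive1_comp (is_derive_expR _) dl.
  by rewrite /= scaler0 expR0 mul1r -[k *: 1]/(k * 1) mulr1.
have [g [gE cg gk]] := (is_derive1_caratheodory _ _ _).1 dk.
apply: (@cvg_trans _ (g t @[t --> 0^'+])); last first.
  by rewrite -gk; exact: cvg_at_right_filter.
apply: near_eq_cvg; near=> t.
have t0 : t != 0 by apply: lt0r_neq0; near: t; exact: nbhs_right_gt.
have gt : expR (k * t) - 1 = g t * t.
  by have := gE t; rewrite mulr0 expR0 subr0.
by rewrite /= gt mulrC mulfK.
Unshelve. all: by end_near. Qed.

(** * The generator *)

Theorem lemma3p4 (R : realType) (H : completeNormedModType R)
  (ip : {dot H for idfun}) (ip_norm : forall x : H, ip x x = `|x| ^+ 2)
  (sepH : separable_space H)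
  (k : R -> R) (hk : admissible_kernel k)
  (M : {measure set (measurableTypeR R) -> \bar R}) (hM : is_tail_measure k M)
  (mu : R -> probability (measurableTypeR R) R)
  (hmu : is_subordinator_law (laplace_exponent M) mu)
  (gamma : R) (hgamma : 0 < gamma)
  (u : R -> H)
  (hu : generator_dom (@subordinated_shift R H mu) u) :
  \int[@lebesgue_measure R]_(s in `[0, +oo[)
     (ip (generator (@subordinated_shift R H mu) u s) (u s)
      * expR (- (gamma * s)))
  <= - (2^-1 * laplace_exponent M gamma
        * \int[@lebesgue_measure R]_(s in `[0, +oo[)
            (`|u s| ^+ 2 * expR (- (gamma * s)))).
Proof.
set U := @subordinated_shift R H mu.
have gamma0 := ltW hgamma.
have [u2 u_gen] := hu.
have [v2 cvv] : is_generator_value U u (generator U u) by exact: xgetPex u_gen.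
set v := generator U u in v2 cvv *.
pose Phi := weighted_pairing ip gamma u.
rewrite -(weighted_pairing_self ip_norm gamma u) -[leLHS]/(Phi v) -[X in _ * X]/(Phi u).
rewrite -mulNr -mulrN; set kappa := 2^-1 * - laplace_exponent M gamma.
(* Phi v <= q t + z t for all t > 0: q bounds Phi of the difference quotient,
   z its distance to v. *)
pose q t := (t^-1 * (expR (kappa * t) - 1) * Phi u)%:E.
pose z t := (l2norm u * l2norm (t^-1 *: (U t u - u) - v)%R)%E.
have u2f := L2_fin_num u2.
have cvb : (q t + z t)%E @[t --> 0^'+] --> ((kappa * Phi u)%:E + l2norm u * 0)%E.
  apply: cvgeD; [by rewrite mule0| |exact: cvgeZl].
  apply: cvg_EFin; first exact: nearW.
  by apply: cvgMl; exact: cvg_expR_quotient.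
rewrite mule0 adde0 in cvb; rewrite -lee_fin; apply: cvge_to_ge cvb _.
near=> t.
have t0 : 0 < t by near: t; exact: nbhs_right_gt.
have [mut0 mutL] := hmu t (ltW t0).
have Ut2 : L2 (U t u) by exact: L2_subordinated_shift.
have PhiU : Phi (U t u) <= expR (kappa * t) * Phi u.
  apply: weighted_pairing_subordinated_shift => //; first exact: expR_gt0.
  by rewrite mutL// -expRM_natl /kappa; congr expR; field.
have d2 : L2 (t^-1 *: (U t u - u)) by apply: L2Z; exact: L2B.
have := norm_weighted_pairing_le ip_norm sepH gamma0 u2 (L2B sepH d2 v2).
have du2 : L2 (U t u - u) by exact: L2B.
rewrite weighted_pairingB// weighted_pairingZ// weighted_pairingB//.
rewrite -/(Phi _) -/(Phi u) -/(Phi v) => err.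
apply: le_trans (leeD (lexx (q t)) err).
rewrite -EFinD lee_fin.
have : t^-1 * (Phi (U t u) - Phi u) <= t^-1 * (expR (kappa * t) - 1) * Phi u.
  by rewrite -mulrA ler_pM2l ?invr_gt0// mulrBl mul1r lerD2r.
have := ler_norm (- (t^-1 * (Phi (U t u) - Phi u) - Phi v)).
rewrite normrN; lra.
Unshelve. all: by end_near. Qed.
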